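(* Let $E$ be a separative bounded meet semilattice. Then $E$ is compactable if and only if $E$ satisfies the trapping condition.
   Context: A bounded meet semilattice is a meet semilattice with a top element $1$ and a bottom element $0$. A filter in $E$ is a nonempty subset $F\subseteq E$ such that $0\notin F$; $e,f\in F$ implies $e\wedge f\in F$; and $e\in F$, $e\le f$ implies $f\in F$. An ultrafilter is a filter that is maximal under inclusion among filters. $\mathsf{U}(E)$ denotes the set of all ultrafilters in $E$, and for $e\in E$, $\mathcal{K}_e$ denotes the set of ultrafilters containing $e$. The sets $\mathcal{K}_e$ ($e\in E$) form a base for a topology $\tau$ on $\mathsf{U}(E)$. $E$ is compactable if $(\mathsf{U}(E),\tau)$ is compact. $E$ is separative if $\mathcal{K}_e=\mathcal{K}_f$ implies $e=f$ for all $e,f\in E$. For $e\in E$ write $e^{\downarrow}=\{x\in E: x\le e\}$ and $e^{\ast}=\{x\in E: x\wedge e=0\}$. For $e\neq 0$, write $e\rightarrow(g_1,\ldots,g_k)$ if for each $x$ with $0\ne x\le e$ there exists $i$ such that $x\wedge g_i\ne 0$. $E$ satisfies the trapping condition if for all $e,f\in E\setminus\{0\}$ with $f<e$ there exist $e_1,\ldots,e_m\in E$, where $m\ge 1$, such that $e\rightarrow(e_1,\ldots,e_m,f)$ and $e_i\in e^{\downarrow}\cap f^{\ast}$ for all $i$. *)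

(* Defs.v *)
From HB Require Import structures.
From mathcomp Require Import all_boot all_order.
From mathcomp Require Import boolp classical_sets topology.

Set Implicit Arguments.
Unset Strict Implicit.
Unset Printing Implicit Defensive.

Import Order.TTheory.

Local Open Scope classical_set_scope.

(* Both scopes use the symbol `&`: meets in E are written under %O, while
   intersections of sets stay in classical_set_scope. *)

Section UltrafilterSpace.
Context {d : Order.disp_t}.

Record meet_filter (E : tbMeetSemilatticeType d) (F : set E) : Prop :=
  MeetFilter {
    meet_filter_neq0 : F !=set0;
    meet_filter_bot : ~ F \bot%O;
    meet_filterI : forall e f : E, F e -> F f -> F (e `&` f)%O;
    meet_filterS : forall e f : E, F e -> (e <= f)%O -> F f }.

Definition meet_ultrafilter (E : tbMeetSemilatticeType d) (F : set E) : Prop :=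
  meet_filter F /\ forall G : set E, meet_filter G -> F `<=` G -> G = F.

Record ultrafilters (E : tbMeetSemilatticeType d) : Type := Ultrafilters {
  ultra_set :> set E;
  ultra_setP : meet_ultrafilter ultra_set }.

HB.instance Definition _ (E : tbMeetSemilatticeType d) :=
  gen_eqMixin (ultrafilters E).
HB.instance Definition _ (E : tbMeetSemilatticeType d) :=
  gen_choiceMixin (ultrafilters E).

Definition ultra_basic (E : tbMeetSemilatticeType d) (e : E) :
    set (ultrafilters E) :=
  [set F : ultrafilters E | (F : set E) e].

Lemma ultra_basic_cover (E : tbMeetSemilatticeType d) :
  \bigcup_(A in range (@ultra_basic E)) A = [set: ultrafilters E].
Proof.
apply/seteqP; split=> // F _.
exists (ultra_basic \top%O); first by exists \top%O.
have [[[e Fe] _ _ FS] _] := ultra_setP F.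
exact: (FS _ _ Fe (lex1 e)).
Qed.

Lemma ultra_basic_join (E : tbMeetSemilatticeType d)
    (A B : set (ultrafilters E)) (F : ultrafilters E) :
  range (@ultra_basic E) A -> range (@ultra_basic E) B -> A F -> B F ->
  exists C : set (ultrafilters E),
    [/\ range (@ultra_basic E) C, C F & C `<=` A `&` B].
Proof.
move=> [e _ <-] [f _ <-] Fe Ff; exists (ultra_basic (e `&` f)%O); split.
- by exists (e `&` f)%O.
- by have [[_ _ FI _] _] := ultra_setP F; apply: FI.
- move=> G Gef; have [[_ _ _ GS] _] := ultra_setP G.
  by split; apply: (GS _ _ Gef); [exact: leIl | exact: leIr].
Qed.

HB.instance Definition _ (E : tbMeetSemilatticeType d) :=
  @isBaseTopological.Build (ultrafilters E) (set (ultrafilters E))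
    (range (@ultra_basic E)) id
    (ultra_basic_cover E) (@ultra_basic_join E).

Definition compactable (E : tbMeetSemilatticeType d) : Prop :=
  compact [set: ultrafilters E].

Definition separative (E : tbMeetSemilatticeType d) : Prop :=
  forall e f : E, ultra_basic e = ultra_basic f -> e = f.

Definition lower_set (E : tbMeetSemilatticeType d) (e : E) : set E :=
  [set x : E | (x <= e)%O].

Definition annihilator (E : tbMeetSemilatticeType d) (e : E) : set E :=
  [set x : E | (x `&` e)%O = \bot%O].

Definition arrow (E : tbMeetSemilatticeType d) (e : E) (gs : seq E) : Prop :=
  forall x : E, x <> \bot%O -> (x <= e)%O ->
    exists2 g : E, g \in gs & (x `&` g)%O <> \bot%O.

Definition trapping (E : tbMeetSemilatticeType d) : Prop :=
  forall e f : E, e <> \bot%O -> f <> \bot%O -> (f < e)%O ->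
    exists es : seq E,
      [/\ (0 < size es)%N,
          arrow e (rcons es f) &
          forall g : E, g \in es -> (lower_set e `&` annihilator f) g].

End UltrafilterSpace.

(* Main.v *)
Require Import Defs.
From mathcomp Require Import all_boot all_order.
From mathcomp Require Import boolp classical_sets filter topology.

(** If [E] is compactable and [0 <> f < e], then the sets [K_g] with [g = f],
    [g] in [f^*] below [e], or [g] in [e^*] cover the ultrafilter space; a finite
    subcover, stripped of [f] and of the members of [e^*], traps [f] in [e].
    Conversely, given an ultrafilter [Phi] of subsets of the space, the elements
    [e] with [K_e] in [Phi] form a filter of [E].  Trapping applied to [e < 1]
    makes that filter maximal: if [K_e] is not in [Phi], then [Phi] contains some
    [K_g] with [g] in [e^*].  Then [Phi] converges to it. *)

Set Implicit Arguments.
Unset Strict Implicit.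
Unset Printing Implicit Defensive.

Import Order.TTheory.

Local Open Scope classical_set_scope.

Section UltrafilterTheory.
Context {d : Order.disp_t} {E : tbMeetSemilatticeType d}.
Implicit Types (e f x : E) (F : ultrafilters E).

Lemma meet_filterI_neq0 (F : set E) e f :
  meet_filter F -> F e -> F f -> (e `&` f)%O <> \bot%O.
Proof. by case=> _ F0 FI _ Fe Ff ef0; apply: F0; rewrite -ef0; exact: FI. Qed.

Lemma principal_meet_filter x :
  x <> \bot%O -> meet_filter [set y | (x <= y)%O].
Proof.
move=> x0; split=> /=.
- by exists x => /=.
- by rewrite lex0 => /eqP.
- by move=> e f xe xf; rewrite lexI xe.
- by move=> e f; exact: le_trans.
Qed.

(* The empty set is admitted in [P] so that the empty chain has an upper bound. *)
Lemma ultra_basic_neq0 x : x <> \bot%O -> ultra_basic x !=set0.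
Proof.
move=> x0.
pose P := [set A : set E | A !=set0 -> meet_filter A /\ A x].
have [C CP Ctot|A [PA Amax]] := @Zorn_bigcup E P.
  move=> [e [X CX Xe]]; have [_ Xx] := CP _ CX (ex_intro _ e Xe).
  split; last by exists X.
  have fP Y a : C Y -> Y a -> meet_filter Y.
    by move=> CY Ya; case: (CP _ CY (ex_intro _ a Ya)).
  split.
  - by exists x, X.
  - by move=> [Y CY Y0]; exact: (meet_filter_bot (fP _ _ CY Y0)).
  - move=> a b [Y CY Ya] [Z CZ Zb].
    case: (Ctot _ _ CY CZ) => [YZ|ZY].
      by exists Z => //; apply: (meet_filterI (fP _ _ CZ Zb)) => //; exact: YZ.
    by exists Y => //; apply: (meet_filterI (fP _ _ CY Ya)) => //; exact: ZY.
  - move=> a b [Y CY Ya] ab; exists Y => //.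
    exact: (meet_filterS (fP _ _ CY Ya) Ya ab).
(* The empty set is not maximal in [P]: the principal filter of [x] lies above it. *)
have [A0|/set0P/negP/negPn/eqP A0] := pselect (A !=set0); last first.
  exfalso; apply: (Amax [set y | (x <= y)%O]).
    rewrite A0 properEneq; split=> //.
    by apply/eqP => /seteqP[_ /(_ x)]; apply => /=.
  by move=> _; split=> /=; first exact: principal_meet_filter.
have [fA Ax] := PA A0.
have uA : meet_ultrafilter A.
  split=> // G fG AG; apply: contrapT => GA; apply: (Amax G).
    by rewrite properEneq; split=> //; apply/eqP => /esym.
  by move=> _; split=> //; exact: AG.
by exists (Ultrafilters uA).
Qed.

Lemma open_ultra_basic e : open (ultra_basic e).
Proof.
exists [set ultra_basic e]; last by rewrite bigcup_set1.
by move=> _ ->; exists e.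
Qed.

Lemma nbhs_ultraP F (A : set (ultrafilters E)) :
  nbhs F A -> exists2 e, (F : set E) e & ultra_basic e `<=` A.
Proof.
rewrite nbhsE => -[B [[D sD <-] [K DK KF]] BA].
have [e _ eK] := sD _ DK; exists e; first by move: KF; rewrite /= -eK.
by move=> G Ge; apply: BA; exists K => //; rewrite /= -eK.
Qed.

(** If no member of [F] annihilated [e], the elements above some [g] meet [e], with [g] in [F],
    would form a filter containing [F] and [e]; maximality of [F] would then force [e] into [F]. *)
Lemma ultra_notinP F e :
  ~ (F : set E) e -> exists2 g, (F : set E) g & (g `&` e)%O = \bot%O.
Proof.
move=> nFe; apply: contrapT => nF; apply: nFe.
have [fF Fmax] := ultra_setP F; have [[a Fa] F0 FI FS] := fF.
pose G := [set y | exists2 g, (F : set E) g & (g `&` e <= y)%O].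
have GF : G = F; last by rewrite -GF; exists a => //; exact: leIr.
apply: Fmax; last by move=> y Fy; exists y => //; exact: leIl.
split.
- by exists a, a => //; exact: leIl.
- by move=> [g Fg]; rewrite lex0 => /eqP ge; apply: nF; exists g.
- move=> y z [g Fg gy] [h Fh hz]; exists (g `&` h)%O; first exact: FI.
  rewrite lexI (le_trans _ gy) ?(le_trans _ hz) //.
    by rewrite leI2 // leIr.
  by rewrite leI2 // leIl.
- by move=> y z [g Fg gy] yz; exists g => //; exact: le_trans yz.
Qed.

(** Meeting the finitely many annihilators given by [ultra_notinP] stays inside [F]. *)
Lemma ultra_notin_seqP F (s : seq E) :
  (forall g, g \in s -> ~ (F : set E) g) ->
  exists2 h, (F : set E) h & forall g, g \in s -> (h `&` g)%O = \bot%O.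
Proof.
have [[[a Fa] _ FI _] _] := ultra_setP F.
elim: s => [_|g s IH sF]; first by exists a.
have [k ks|h Fh hs] := IH; first by apply: sF; rewrite inE ks orbT.
have [k Fk kg] := ultra_notinP (sF g (mem_head _ _)).
exists (h `&` k)%O; first exact: FI.
move=> l; rewrite inE => /orP[/eqP->|/hs hl]; first by rewrite -meetA kg meetx0.
by rewrite meetAC hl meet0x.
Qed.

(** Converse of [ultra_notinP]: a filter extending [F] by some [e] outside [F] would also contain an
    annihilator of [e], hence the bottom. *)
Lemma meet_ultrafilterP (F : set E) :
  meet_filter F ->
  (forall e, ~ F e -> exists2 g, F g & (g `&` e)%O = \bot%O) ->
  meet_ultrafilter F.
Proof.
move=> fF Fd; split=> // G fG FG; apply/seteqP; split=> // e Ge.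
apply: contrapT => /Fd[g Fg]; apply: meet_filterI_neq0 fG _ Ge.
exact: FG.
Qed.

(* The library's [compact_cover] requires a pointed space, whereas [ultrafilters E]
   may be empty. *)
Lemma compactable_finite_cover (D : set E) :
  compactable E -> (forall F, exists2 g, D g & (F : set E) g) ->
  exists2 s : seq E, (forall g, g \in s -> D g) &
    forall F, exists2 g, g \in s & (F : set E) g.
Proof.
move=> cE covD; apply: contrapT => nocov.
pose missing (s : seq E) := [set F : ultrafilters E | forall g, g \in s -> ~ (F : set E) g].
(* [Phi] is generated by the complements of finite unions of sets [K_g]. It is proper because no
   finite subfamily covers, and a cluster point in [K_g] would contradict [missing [:: g]]. *)
pose Phi := [set A | exists2 s : seq E,
  (forall g, g \in s -> D g) & missing s `<=` A].
have Phi_filter : ProperFilter Phi.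
  split.
    move=> [s sD s0]; apply: nocov; exists s => // F.
    by apply: contrapT => nF; apply: (s0 F) => g gs Fg; apply: nF; exists g.
  split.
  - by exists [::].
  - move=> A B [s sD sA] [t tD tB]; exists (s ++ t).
      by move=> g; rewrite mem_cat => /orP[/sD|/tD].
    move=> F Fst; split; [apply: sA|apply: tB] => g gs; apply: Fst;
      by rewrite mem_cat gs ?orbT.
  - by move=> A B AB [s sD sA]; exists s => //; exact: subset_trans AB.
have [F [_ clF]] := cE Phi Phi_filter filterT.
have [g Dg Fg] := covD F.
have [|G [nGg Gg]] := clF (missing [:: g]) (ultra_basic g) _
    (open_nbhs_nbhs (conj (open_ultra_basic g) Fg)).
  by exists [:: g] => // h; rewrite inE => /eqP->.
exact: (nGg g (mem_head _ _) Gg).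
Qed.

Lemma compactable_trapping : compactable E -> trapping E.
Proof.
move=> cE e f e0 f0 fe.
pose D := [set g | g = f \/ (lower_set e `&` annihilator f) g \/
                   annihilator e g].
have [F|s sD scov] := compactable_finite_cover (D := D) cE.
  have [fF _] := ultra_setP F.
  have [Fe|/ultra_notinP[g Fg ge]] := pselect ((F : set E) e); last first.
    by exists g => //; right; right.
  have [Ff|/ultra_notinP[g Fg gf]] := pselect ((F : set E) f).
    by exists f => //; left.
  (* Meeting with [e] brings the annihilator of [f] below [e] without leaving [F]. *)
  exists (g `&` e)%O; last exact: meet_filterI.
  right; left; split; first exact: leIr.
  by rewrite /annihilator /= meetAC gf meet0x.
(* [\bot] pads the list, which must be nonempty. *)
exists (\bot%O :: [seq g <- s | (g <= e)%O && ((g `&` f)%O == \bot%O)]).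
split=> //.
(* An ultrafilter through [x] contains some [g] of the subcover, so [x] meets [g]. It also contains
   [e], so [g] is not in [e^*] and survives the filtering unless it is [f]. *)
- move=> x x0 xe; have [F Fx] := ultra_basic_neq0 x0.
  have [fF _] := ultra_setP F.
  have [g gs Fg] := scov F; have xg0 := meet_filterI_neq0 fF Fx Fg.
  exists g => //; rewrite mem_rcons !inE mem_filter gs andbT.
  have [->|[[ge gf]|ge]] := sD _ gs; first by rewrite eqxx.
    by rewrite [(g <= e)%O]ge gf eqxx !orbT.
  have Fe := meet_filterS fF Fx xe.
  by case: (meet_filterI_neq0 fF Fg Fe).
- move=> g; rewrite inE mem_filter => /orP[/eqP->|/andP[/andP[ge /eqP gf] _]] //.
  by split; [exact: le0x|exact: meet0x].
Qed.

(** Otherwise [Phi] would contain every complement of [K_g], hence their finite intersection, which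
    is empty by the covering hypothesis. *)
Lemma ultrafilter_seq_cover (Phi : set_system (ultrafilters E)) (s : seq E) :
  UltraFilter Phi -> (forall F, exists2 g, g \in s & (F : set E) g) ->
  exists2 g, g \in s & Phi (ultra_basic g).
Proof.
move=> uPhi scov; apply: contrapT => nPhi.
have sC (t : seq E) : {subset t <= s} ->
    Phi [set F : ultrafilters E | forall g, g \in t -> ~ (F : set E) g].
  elim: t => [_|g t IH ts]; first by apply: filterS filterT.
  have gC : Phi (~` ultra_basic g).
    have [Pg|//] := in_ultra_setVsetC (ultra_basic g) uPhi.
    by case: nPhi; exists g => //; rewrite ts ?mem_head.
  have tC : {subset t <= s} by move=> h ht; apply: ts; rewrite inE ht orbT.
  apply: filterS (filterI gC (IH tC)) => F [Fg Ft] h.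
  by rewrite inE => /orP[/eqP->|/Ft].
have [F Fs] := filter_ex (sC s (fun _ => id)).
by have [g gs Fg] := scov F; exact: (Fs g gs Fg).
Qed.

Lemma trapping_compactable : trapping E -> compactable E.
Proof.
move=> trE; rewrite /compactable compact_ultra => Phi uPhi _.
pose F := [set e | Phi (ultra_basic e)].
have fF : meet_filter F.
  split.
  - exists \top%O; apply: filterS filterT => G _.
    by have [[[g Gg] _ _ GS] _] := ultra_setP G; apply: GS Gg (lex1 _).
  - by move=> /filter_ex[G]; have [[_ G0 _ _] _] := ultra_setP G.
  - move=> e f Pe Pf; apply: filterS (filterI Pe Pf) => G [Ge Gf].
    by have [[_ _ GI _] _] := ultra_setP G; exact: GI.
  - move=> e f Pe ef; apply: filterS Pe => G Ge.
    by have [[_ _ _ GS] _] := ultra_setP G; exact: GS ef.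
have uF : meet_ultrafilter F.
  apply: meet_ultrafilterP => // e nFe.
  have Ftop : F \top%O by have [[a Fa] _ _ FS] := fF; apply: FS Fa (lex1 _).
  have [->|/eqP e0] := eqVneq e \bot%O; first by exists \top%O => //; rewrite meetx0.
  have e1 : (e < \top)%O by rewrite ltx1; apply/eqP => e1; apply: nFe; rewrite e1.
  have t0 : \top%O <> \bot%O :> E by move=> t0; apply: (meet_filter_bot fF); rewrite -t0.
  have [es [_ arr esP]] := trE _ _ t0 e0 e1.
  (* The trap covers the space: an ultrafilter missing all of [rcons es e] would contain a nonzero
     [h] annihilating each entry, against [arr]. *)
  have [G|g] := @ultrafilter_seq_cover Phi (rcons es e) uPhi.
    have [[_ G0 _ _] _] := ultra_setP G.
    apply: contrapT => nG.
    have [|h Gh hP] := @ultra_notin_seqP G (rcons es e).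
      by move=> g gs Gg; apply: nG; exists g.
    have h0 : h <> \bot%O by move=> h0; apply: G0; rewrite -h0.
    by have [g gs] := arr h h0 (lex1 h); rewrite hP.
  rewrite mem_rcons inE => /orP[/eqP-> //|gs Fg].
  by exists g => //; have [_] := esP _ gs.
exists (Ultrafilters uF); split=> // A /nbhs_ultraP[e Fe eA].
exact: filterS eA Fe.
Qed.

End UltrafilterTheory.

Theorem theorem2p10 (d : Order.disp_t) (E : tbMeetSemilatticeType d) :
  separative E -> (compactable E <-> trapping E).
Proof.
by move=> _; split; [exact: compactable_trapping | exact: trapping_compactable].
Qed.
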